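(* Let $D_{(<,>)}(x)$ be the generating function, with respect to the length, for the total number of descents over all Catalan words avoiding the ordered pair of relations $(<,>)$. Then $$D_{(<,>)}(x)=\frac{1 - 4 x + 3 x^2 -(1-2x) \sqrt{1 - 4 x + 2 x^2 + x^4}}{2 (1 - x) x\sqrt{1 - 4 x + 2 x^2 + x^4}}.$$
   Context: A Catalan word of length $n$ is a word $w=w_1w_2\cdots w_n$ over the non-negative integers with $w_1=0$ and $0\leq w_i\leq w_{i-1}+1$ for $i=2,\dots,n$; the empty word is the unique Catalan word of length $0$. For relations $X,Y\in\{<,>,\leq,\geq,=,\neq\}$, a word $w$ contains the pattern $(X,Y)$ if there is an index $i\geq 1$ (with $i+2\le n$) such that $w_i\,X\,w_{i+1}$ and $w_{i+1}\,Y\,w_{i+2}$; otherwise $w$ avoids $(X,Y)$. The number of descents $\mathrm{des}(w)$ is the number of indices $i$ with $w_i>w_{i+1}$. With $C_{(X,Y)}(x,y)=\sum_{w}x^{|w|}y^{\mathrm{des}(w)}$, the sum being over all Catalan words $w$ (of any length $|w|\ge 0$) avoiding $(X,Y)$, one sets $D_{(X,Y)}(x)=\left.\frac{\partial C_{(X,Y)}(x,y)}{\partial y}\right|_{y=1}=\sum_w \mathrm{des}(w)\,x^{|w|}$. Identities are between formal power series in $x$ (after clearing denominators); the square root of a power series with constant term $1$ is the one with constant term $1$. *)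

(* Defs.v *)
From HB Require Import structures.
From mathcomp Require Import all_boot all_order all_algebra boolp.

Set Implicit Arguments.
Unset Strict Implicit.
Unset Printing Implicit Defensive.

Import Order.TTheory GRing.Theory Num.Theory.

(* Words over the non-negative integers are [seq nat].  Letters are indexed
   from 0 here, so w_i is [nth 0 w i.-1]. *)

Section Words.
Local Open Scope nat_scope.

(* The default value of [nth] makes the empty word Catalan. *)
Definition catalan_word (w : seq nat) : bool :=
  (nth 0 w 0 == 0) &&
  [forall i : 'I_(size w).-1, nth 0 w i.+1 <= (nth 0 w i).+1].

Definition contains_rel (X Y : rel nat) (w : seq nat) : bool :=
  [exists i : 'I_(size w - 2),
     X (nth 0 w i) (nth 0 w i.+1) && Y (nth 0 w i.+1) (nth 0 w i.+2)].

Definition avoids_rel (X Y : rel nat) (w : seq nat) : bool :=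
  ~~ contains_rel X Y w.

Definition des (w : seq nat) : nat :=
  #|[set i : 'I_(size w).-1 | nth 0 w i > nth 0 w i.+1]|.

(* A Catalan word of length n only uses the letters 0, ..., n-1
   ([catalan_word_of_tuple] below), so the Catalan words of length n are
   enumerated by the finite type of n-tuples over 'I_n. *)
Definition word_of n (t : n.-tuple 'I_n) : seq nat := map (@nat_of_ord n) t.

Definition avoiding_catalan_words (X Y : rel nat) n : {set n.-tuple 'I_n} :=
  [set t | catalan_word (word_of t) && avoids_rel X Y (word_of t)].

Lemma word_of_inj n : injective (@word_of n).
Proof. by move=> t u /(inj_map val_inj) /val_inj. Qed.

Lemma size_word_of n (t : n.-tuple 'I_n) : size (word_of t) = n.
Proof. by rewrite size_map size_tuple. Qed.

Lemma catalan_word_nth w i : catalan_word w -> nth 0 w i <= i.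
Proof.
case/andP=> /eqP w0 /forallP wS; elim: i => [|i IHi]; first by rewrite w0.
case: (ltnP i (size w).-1) => [lti|gei].
  exact: leq_trans (wS (Ordinal lti)) _.
by rewrite nth_default // (leq_trans (leqSpred _)).
Qed.

Lemma catalan_word_of_tuple w : catalan_word w ->
  exists t : (size w).-tuple 'I_(size w), word_of t = w.
Proof.
move=> Cw; have lt_w (i : 'I_(size w)) : nth 0 w i < size w.
  exact: leq_ltn_trans (catalan_word_nth i Cw) (ltn_ord i).
exists [tuple Ordinal (lt_w i) | i < size w].
apply: (@eq_from_nth _ 0); rewrite size_word_of // => i lti.
rewrite /word_of -map_comp (nth_map (Ordinal lti)) ?size_enum_ord //=.
by rewrite nth_enum_ord.
Qed.

Lemma des_le_size w : des w <= size w.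
Proof.
apply: leq_trans (max_card _) _; rewrite card_ord; exact: leq_pred.
Qed.

End Words.

Local Open Scope ring_scope.

(* Formal power series in one variable, as a commutative ring under the
   Cauchy product; [f n] is the coefficient of x^n in f. *)
Record fps (R : Type) := Fps { coef_fps :> nat -> R }.

Lemma fpsP (R : Type) (f g : fps R) : (forall n, f n = g n) <-> f = g.
Proof.
split=> [|-> //]; case: f g => [f] [g] /= fg.
by congr Fps; apply: funext.
Qed.

HB.instance Definition _ (R : Type) := gen_eqMixin (fps R).
HB.instance Definition _ (R : Type) := gen_choiceMixin (fps R).

Section FpsRing.
Variable R : comNzRingType.
Implicit Types f g h : fps R.

Definition fps0 : fps R := Fps (fun _ => 0).
Definition fps_opp f : fps R := Fps (fun n => - f n).
Definition fps_add f g : fps R := Fps (fun n => f n + g n).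
Definition fps1 : fps R := Fps (fun n => (n == 0%N)%:R).
Definition fps_mul f g : fps R :=
  Fps (fun n => \sum_(i < n.+1) f i * g (n - i)%N).

Fact fps_addA : associative fps_add.
Proof. by move=> f g h; apply/fpsP => n /=; rewrite addrA. Qed.
Fact fps_addC : commutative fps_add.
Proof. by move=> f g; apply/fpsP => n /=; rewrite addrC. Qed.
Fact fps_add0 : left_id fps0 fps_add.
Proof. by move=> f; apply/fpsP => n /=; rewrite add0r. Qed.
Fact fps_addN : left_inverse fps0 fps_opp fps_add.
Proof. by move=> f; apply/fpsP => n /=; rewrite addNr. Qed.

HB.instance Definition _ :=
  GRing.isZmodule.Build (fps R) fps_addA fps_addC fps_add0 fps_addN.

Let tr m f : {poly R} := \poly_(i < m) f i.

Let fps_mul_tr m f g n : (n < m)%N -> fps_mul f g n = (tr m f * tr m g)`_n.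
Proof.
move=> ltnm; rewrite coefM /=; apply: eq_bigr => i _.
by rewrite !coef_poly !ifT // (leq_ltn_trans _ ltnm) ?leq_subr // -ltnS.
Qed.

Fact fps_mulC : commutative fps_mul.
Proof.
by move=> f g; apply/fpsP => n; rewrite !(@fps_mul_tr n.+1) // mulrC.
Qed.

Fact fps_mulA : associative fps_mul.
Proof.
move=> f g h; apply/fpsP => n.
have trM p q i : (i < n.+1)%N ->
    (tr n.+1 (fps_mul p q))`_i = (tr n.+1 p * tr n.+1 q)`_i.
  by move=> lti; rewrite coef_poly lti (@fps_mul_tr n.+1).
rewrite !(@fps_mul_tr n.+1) //.
transitivity ((tr n.+1 f * (tr n.+1 g * tr n.+1 h))`_n).
  by rewrite !coefM; apply: eq_bigr => i _; rewrite trM // ltnS leq_subr.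
by rewrite mulrA !coefM; apply: eq_bigr => i _; rewrite trM.
Qed.

Fact fps_mul1 : left_id fps1 fps_mul.
Proof.
move=> f; apply/fpsP => n /=; rewrite big_ord_recl subn0 mul1r big1 ?addr0 //.
by move=> i _; rewrite mul0r.
Qed.

Fact fps_mulDl : left_distributive fps_mul fps_add.
Proof.
move=> f g h; apply/fpsP => n /=; rewrite -big_split /=.
by apply: eq_bigr => i _; rewrite mulrDl.
Qed.

Fact fps1_neq0 : fps1 != fps0.
Proof. by apply/eqP => /fpsP/(_ 0%N)/eqP; rewrite /= oner_eq0. Qed.

HB.instance Definition _ := GRing.Zmodule_isComNzRing.Build (fps R)
  fps_mulA fps_mulC fps_mul1 fps_mulDl fps1_neq0.

Definition fpsX : fps R := Fps (fun n => (n == 1%N)%:R).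

Lemma coef_fps0 n : (0 : fps R) n = 0. Proof. by []. Qed.
Lemma coef_fps1 n : (1 : fps R) n = (n == 0%N)%:R. Proof. by []. Qed.
Lemma coef_fpsX n : fpsX n = (n == 1%N)%:R. Proof. by []. Qed.
Lemma coef_fpsN f n : (- f) n = - f n. Proof. by []. Qed.
Lemma coef_fpsD f g n : (f + g) n = f n + g n. Proof. by []. Qed.
Lemma coef_fpsM f g n : (f * g) n = \sum_(i < n.+1) f i * g (n - i)%N.
Proof. by []. Qed.

Lemma coef_fpsXM f n : (fpsX * f) n = if n is m.+1 then f m else 0.
Proof.
rewrite coef_fpsM big_ord_recl mul0r add0r.
case: n => [|n]; first by rewrite big_ord0.
rewrite big_ord_recl /= mul1r subSS subn0 big1 ?addr0 // => i _.
by rewrite mul0r.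
Qed.

End FpsRing.

Arguments fpsX {R}.

(* The square root, with constant term 1, of a power series f with constant
   term 1: from s ^+ 2 = f one gets, for n > 0,
     2 s_n = f_n - \sum_(0 < i < n) s_i s_(n-i).
   [fps_sqrt_prefix f n] lists s_0, ..., s_(n-1). *)
Section FpsSqrt.
Variable F : numFieldType.
Implicit Types f s : fps F.

Fixpoint fps_sqrt_prefix f (n : nat) : seq F :=
  if n is m.+1 then
    let s := fps_sqrt_prefix f m in
    rcons s (if m == 0%N then 1
             else (f m - \sum_(1 <= i < m) s`_i * s`_(m - i)) / 2)
  else [::].

Definition fps_sqrt f : fps F := Fps (fun n => (fps_sqrt_prefix f n.+1)`_n).

Let size_prefix f n : size (fps_sqrt_prefix f n) = n.
Proof. by elim: n => //= n IHn; rewrite size_rcons IHn. Qed.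

Let nth_prefix f n i : (i < n)%N -> (fps_sqrt_prefix f n)`_i = fps_sqrt f i.
Proof.
elim: n => // n IHn; rewrite ltnS leq_eqVlt => /predU1P[-> // | lti].
by rewrite /= nth_rcons size_prefix lti IHn.
Qed.

Lemma fps_sqrt0 f : fps_sqrt f 0%N = 1.
Proof. by []. Qed.

Lemma fps_sqrtS f n : (0 < n)%N -> fps_sqrt f n =
  (f n - \sum_(1 <= i < n) fps_sqrt f i * fps_sqrt f (n - i)%N) / 2.
Proof.
move=> n_gt0; rewrite {1}/fps_sqrt /= nth_rcons size_prefix ltnn eqxx.
rewrite eqn0Ngt n_gt0 /=; congr ((_ - _) / _).
rewrite !big_nat; apply: eq_bigr => i /andP[i_gt0 ltin].
by rewrite !nth_prefix // ltn_subrL i_gt0.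
Qed.

Let coef_sqr s n : (0 < n)%N -> s 0%N = 1 ->
  (s ^+ 2) n = s n *+ 2 + \sum_(1 <= i < n) s i * s (n - i)%N.
Proof.
case: n => // n _ s0; rewrite expr2 coef_fpsM.
rewrite -(big_mkord xpredT (fun i => s i * s (n.+1 - i)%N)).
rewrite big_nat_recr //= big_nat_recl //= subnn subn0 s0 mul1r mulr1.
by rewrite addrAC -mulr2n big_add1 /=.
Qed.

Lemma fps_sqrt_sqr f : f 0%N = 1 -> fps_sqrt f ^+ 2 = f.
Proof.
move=> f0; apply/fpsP => -[|n].
  by rewrite expr2 coef_fpsM big_ord_recl big_ord0 fps_sqrt0 f0 mulr1 addr0.
rewrite coef_sqr // -mulr_natr {1}fps_sqrtS // divfK ?pnatr_eq0 //.
by rewrite subrK.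
Qed.

Lemma fps_sqrt_unique f s : s 0%N = 1 -> s ^+ 2 = f -> s = fps_sqrt f.
Proof.
move=> s0 <-; apply/fpsP; elim/ltn_ind => -[|n] IHn; first exact: s0.
rewrite fps_sqrtS // coef_sqr // -[s n.+1 *+ 2]mulr_natr.
rewrite [X in _ + X - _]big_nat [X in _ + _ - X]big_nat.
rewrite (eq_bigr (fun i => fps_sqrt (s ^+ 2) i * fps_sqrt (s ^+ 2) (n.+1 - i)%N)).
  by rewrite addrK mulfK // pnatr_eq0.
by move=> i /andP[i_gt0 ltin]; rewrite !IHn // ltn_subrL i_gt0.
Qed.

End FpsSqrt.

Section GeneratingFunctions.
Variables X Y : rel nat.

(* C_(X,Y)(x,y), as a power series in x whose coefficients are polynomials
   in y. *)
Definition catalan_gf : fps {poly rat} :=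
  Fps (fun n => \sum_(t in avoiding_catalan_words X Y n) 'X^(des (word_of t))).

Definition total_des_gf : fps rat :=
  Fps (fun n => \sum_(t in avoiding_catalan_words X Y n) (des (word_of t))%:R).

Lemma total_des_gf_deriv n : total_des_gf n = (catalan_gf n)^`().[1].
Proof.
rewrite /= raddf_sum horner_sum; apply: eq_bigr => t _.
by rewrite /= derivXn hornerMn hornerXn expr1n.
Qed.

End GeneratingFunctions.

(* Main.v *)
(** Read a word from left to right, remembering the last letter [k] and whether
    the last step was an ascent.  The generating functions [F_k] (last step not
    an ascent) and [G_k] (ascent) of the admissible continuations satisfy
    [G_k = 1 + x G_(k+1) + x F_k] and [F_k = G_k + x y (F_0 + ... + F_(k-1))].
    This system has a unique solution, and it is geometric in [k]:
    [F_k = P L^k] with [L = 1 + x y (1 - x) P], as soon as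
    [P = 1 + 2 x P - x^2 y P + x^2 y (1 - x) P^2].  Hence [C = 1 + x P];
    differentiating the quadratic equation at [y = 1] and using that
    [1 - x^2 - 2 x (1 - x) C(x, 1)] is the square root of its discriminant
    gives the formula. *)
Require Import Defs.
From mathcomp Require Import all_boot all_order all_algebra ring.

Set Implicit Arguments.
Unset Strict Implicit.
Unset Printing Implicit Defensive.

Import GRing.Theory.

(** * Avoidance as a letter-by-letter condition *)

Local Open Scope nat_scope.

(* [b] records whether the letter [k] was reached by an ascent. *)
Fixpoint continuation (b : bool) (k : nat) (v : seq nat) : bool :=
  if v is a :: v' then
    [&& a <= k.+1, ~~ (b && (a < k)) & continuation (k < a) a v']
  else true.

Lemma forall_ordS n (P : pred 'I_n.+1) :
  [forall i, P i] = P ord0 && [forall i : 'I_n, P (lift ord0 i)].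
Proof. by rewrite -!(big_andE xpredT) big_ord_recl. Qed.

Lemma exists_ordS n (P : pred 'I_n.+1) :
  [exists i, P i] = P ord0 || [exists i : 'I_n, P (lift ord0 i)].
Proof. by rewrite -!(big_orE xpredT) big_ord_recl. Qed.

Lemma forall_ord0 (P : pred 'I_0) : [forall i, P i] = true.
Proof. by apply/forallP => -[]. Qed.

Lemma exists_ord0 (P : pred 'I_0) : [exists i, P i] = false.
Proof. by apply/existsP => -[[]]. Qed.

Lemma avoids_rel_cons2 X Y a c v :
  avoids_rel X Y [:: a, c & v] =
  (if v is e :: _ then ~~ (X a c && Y c e) else true) && avoids_rel X Y (c :: v).
Proof.
rewrite /avoids_rel /contains_rel.
case: v => [|e v]; first by rewrite !exists_ord0.
by rewrite /= !subSS !subn0 exists_ordS negb_or.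
Qed.

(** The first conjunct stands for the one triple not contained in [k :: v]: the letter before [k],
    then [k], then the head of [v]. *)
Lemma continuationE b k v :
  continuation b k v =
  [&& (if v is a :: _ then ~~ (b && (a < k)) else true),
      [forall i : 'I_(size v), nth 0 (k :: v) i.+1 <= (nth 0 (k :: v) i).+1]
    & avoids_rel ltn gtn (k :: v)].
Proof.
elim: v b k => [|a v IHv] b k.
  by rewrite /avoids_rel /contains_rel /= forall_ord0 exists_ord0.
rewrite avoids_rel_cons2 /= forall_ordS /= IHv.
rewrite andbCA -andbA; do 2!congr (_ && _).
by rewrite andbCA; case: v {IHv}.
Qed.

(** The first letter has no predecessor, so no ascent leads to it and [b] starts at [false]. *)
Lemma avoiding_catalan_cons a v :
  catalan_word (a :: v) && avoids_rel ltn gtn (a :: v) =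
  (a == 0) && continuation false 0 v.
Proof.
rewrite continuationE /catalan_word /=.
by case: eqP => //= ->; case: v.
Qed.

Lemma des_cons2 a c v : des [:: a, c & v] = (c < a) + des (c :: v).
Proof.
rewrite /des !cardsE -!sum1_card /= [LHS]big_mkcond big_ord_recl /=.
by rewrite [in RHS]big_mkcond /=; congr (_ + _); rewrite unfold_in /=; case: ltnP.
Qed.

(** * Enumeration of the admissible continuations *)

Fixpoint continuations (b : bool) (k n : nat) : seq (seq nat) :=
  if n is n'.+1 then
    [seq k.+1 :: v | v <- continuations true k.+1 n'] ++
    [seq k :: v | v <- continuations false k n'] ++
    (if b then [::]
     else [seq j :: v | j <- iota 0 k, v <- continuations false j n'])
  else [:: [::]].

(** The three blocks of the list correspond to a next letter equal to [k.+1], equal to [k], or below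
    [k]; the last is ruled out after an ascent. *)
Lemma mem_continuations b k n v :
  (v \in continuations b k n) = (size v == n) && continuation b k v.
Proof.
elim: n b k v => [|n IHn] b k v; first by case: v.
rewrite [continuations _ _ _]/= !mem_cat.
have mem_map_cons c j s w :
    (w \in [seq j :: u | u <- continuations c s n]) =
    if w is a :: w' then (a == j) && (w' \in continuations c s n) else false.
  case: w => [|a w]; first by apply/mapP => -[].
  apply/mapP/andP => [[u uS [-> ->]] | [/eqP-> wS]]; first by [].
  by exists w.
rewrite !mem_map_cons.
have -> : (v \in if b then [::]
     else [seq j :: u | j <- iota 0 k, u <- continuations false j n]) =
    if v is a :: v' then [&& ~~ b, a < k & v' \in continuations false a n]
    else false.
  case: b; first by case: v.
  case: v => [|a v]; first by apply/allpairsPdep => -[? [? []]].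
  apply/allpairsPdep/and3P => [[j [u [jk uS [-> ->]]]]|[_ ak vS]].
    by rewrite mem_iota in jk.
  by exists a, v; rewrite mem_iota.
case: v => [|a v] //=; rewrite !IHn eqSS [a <= k.+1]leq_eqVlt ltnS.
case: (ltngtP a k) => [ak | ka | ->].
- by rewrite (ltn_eqF (leqW ak)) orbT; case: b; rewrite ?andbF.
- by rewrite !andbF !orbF /=; case: eqP => [->|_] //=; rewrite andbF.
- by rewrite (ltn_eqF (ltnSn k)) !andbF orbF.
Qed.

Lemma continuations_uniq b k n : uniq (continuations b k n).
Proof.
elim: n b k => [|n IHn] b k //=.
have cons_inj (j : nat) : injective (cons j) by move=> u v [].
rewrite !cat_uniq !map_inj_uniq ?IHn //=; apply/and3P; split.
- apply/hasPn => w; rewrite mem_cat => wS; apply/mapP => -[u _ def_w].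
  case/orP: wS => [/mapP[? _]|]; first by rewrite def_w => -[] /eqP; rewrite gtn_eqF.
  case: b => //; case/allpairsPdep => j [? [jk _]]; rewrite def_w => -[def_j _].
  by rewrite -def_j mem_iota /= add0n ltnNge leqnSn in jk.
- case: b; first by [].
  apply/hasPn => w /allpairsPdep[j [? [jk _ ->]]]; apply/mapP => -[u _ [def_j _]].
  by rewrite def_j mem_iota /= add0n ltnn in jk.
case: b => //; apply: allpairs_uniq_dep => [|j _|]; rewrite ?iota_uniq ?IHn //.
by move=> [j u] [j' u'] _ _ /= [-> ->].
Qed.

Local Open Scope ring_scope.

(** Both sides run over duplicate-free lists with the same members. The forced initial [0] accounts
    for the shift from [n.+1] to [n]. *)
Lemma sum_avoiding_catalan_words (R : nmodType) (h : seq nat -> R) n :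
  \sum_(t in avoiding_catalan_words ltn gtn n.+1) h (word_of t) =
  \sum_(v <- continuations false 0 n) h (0%N :: v).
Proof.
rewrite -big_enum -(big_map (@word_of _) xpredT h).
rewrite -(big_map (cons 0%N) xpredT h); apply: perm_big; apply: uniq_perm.
- by rewrite (map_inj_uniq (@word_of_inj _)) enum_uniq.
- by rewrite map_inj_uniq ?continuations_uniq // => u v [].
move=> w; apply/mapP/mapP => [[t]|[v]].
  rewrite mem_enum inE => Ct.
  move: (size_word_of t) Ct; case: (word_of t) => // a v /= [sz].
  rewrite avoiding_catalan_cons => /andP[/eqP-> Cv] ->.
  by exists v; rewrite // mem_continuations sz eqxx.
rewrite mem_continuations => /andP[/eqP sz Cv] ->.
have := avoiding_catalan_cons 0 v; rewrite Cv eqxx => /andP[Cw Aw].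
have [t def_w] := catalan_word_of_tuple Cw.
move: t def_w; rewrite /= sz => t def_w; exists t; last by [].
by rewrite mem_enum inE def_w Cw Aw.
Qed.

(** * Generating functions of continuations and their linear system *)

Section ContinuationSeries.
Variables (R : comNzRingType) (y : R).
Local Notation x := (fpsX : fps R).

Definition fpsC : fps R := Fps (fun n => if n is 0%N then y else 0).

Lemma coef_fpsCM (f : fps R) n : (fpsC * f) n = y * f n.
Proof.
rewrite coef_fpsM big_ord_recl subn0 big1 ?addr0 // => i _.
by rewrite mul0r.
Qed.

Lemma coef_fps_sum I (r : seq I) (f : I -> fps R) n :
  (\sum_(i <- r) f i) n = \sum_(i <- r) f i n.
Proof. by elim: r => [|i r IHr]; rewrite ?big_nil // !big_cons coef_fpsD IHr. Qed.

Definition cont_gf b k : fps R :=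
  Fps (fun n => \sum_(v <- continuations b k n) y ^+ des (k :: v)).

Lemma coef_cont_gfS b k n :
  cont_gf b k n.+1 = cont_gf true k.+1 n + cont_gf false k n +
    (if b then 0 else y * \sum_(j < k) cont_gf false j n).
Proof.
rewrite /= !big_cat /= !big_map addrA; congr (_ + _ + _).
- by apply: eq_bigr => v _; rewrite des_cons2 ltnNge leqnSn.
- by apply: eq_bigr => v _; rewrite des_cons2 ltnn.
case: b; first by rewrite big_nil.
rewrite big_allpairs_dep mulr_sumr -(big_mkord xpredT
  (fun j => y * \sum_(v <- continuations false j n) y ^+ des (j :: v))) /=.
rewrite /index_iota subn0 !big_seq; apply: eq_bigr => j; rewrite mem_iota /= => jk.
by rewrite mulr_sumr; apply: eq_bigr => v _; rewrite des_cons2 jk exprS.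
Qed.

(** Every unknown on the right carries a factor [x], so the coefficients of index [n] for all [b]
    and [k] determine those of index [n.+1]. *)
Lemma cont_gf_unique (H : bool -> nat -> fps R) :
  (forall b k, H b k = 1 + x * (H true k.+1 + H false k +
     (if b then 0 else fpsC * \sum_(j < k) H false j))) ->
  forall b k, cont_gf b k = H b k.
Proof.
move=> HE b k; apply/fpsP => n; elim: n b k => [|n IHn] b k.
  rewrite HE coef_fpsD coef_fpsXM coef_fps1 addr0 /= big_seq1.
  by rewrite /des cardsE eq_card0 // => -[].
rewrite HE coef_fpsD coef_fpsXM coef_fps1 add0r coef_cont_gfS !coef_fpsD !IHn.
congr (_ + _); case: b; first by [].
by rewrite coef_fpsCM coef_fps_sum; congr (_ * _); apply: eq_bigr => j _.
Qed.

(** * The quadratic equation [P = 1 + x * cont_step P] *)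

Definition cont_step (P : fps R) : fps R :=
  P + P + x * (fpsC * ((1 - x) * (P * P) - P)).

Lemma coef_fpsM_eq (f f' g g' : fps R) n :
  (forall i, (i <= n)%N -> f i = f' i) -> (forall i, (i <= n)%N -> g i = g' i) ->
  forall i, (i <= n)%N -> (f * g) i = (f' * g') i.
Proof.
move=> ff' gg' i le_in; rewrite !coef_fpsM; apply: eq_bigr => j _.
by rewrite ff' ?gg' // (leq_trans _ le_in) ?leq_subr // -ltnS.
Qed.

Lemma cont_step_eq (P Q : fps R) n :
  (forall i, (i <= n)%N -> P i = Q i) ->
  forall i, (i <= n)%N -> cont_step P i = cont_step Q i.
Proof.
move=> PQ i le_in; rewrite /cont_step !(coef_fpsD _ _ i) PQ //; congr (_ + _).
apply: (coef_fpsM_eq (n := n)) le_in => // {}i; apply: coef_fpsM_eq => // {}i le_in.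
rewrite !(coef_fpsD _ _ i) !coef_fpsN PQ //; congr (_ - _).
by apply: (coef_fpsM_eq (n := n)) le_in => // {}i; apply: coef_fpsM_eq.
Qed.

(** Fixed-point iteration from [0]: the factor [x] makes each round settle one more coefficient. *)
Lemma cont_eq_exists : exists P, P = 1 + x * cont_step P.
Proof.
pose it m := iter m (fun P => 1 + x * cont_step P) 0.
have itS m n : it m.+1 n.+1 = cont_step (it m) n.
  by rewrite /it iterS coef_fpsD coef_fpsXM coef_fps1 add0r.
have it0 m : it m.+1 0%N = 1.
  by rewrite /it iterS coef_fpsD coef_fpsXM addr0.
have stable m i : (i < m)%N -> it m i = it m.+1 i.
  elim: m i => // m IHm [|i] lt_im; first by rewrite !it0.
  rewrite !itS; case: m IHm lt_im => // m IHm lt_im.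
  by apply: (@cont_step_eq _ _ m) lt_im => j; apply: IHm.
have stab m i d : (i < m)%N -> it (m + d)%N i = it m i.
  move=> lt_im; elim: d => [|d IHd]; first by rewrite addn0.
  by rewrite addnS -stable ?IHd // (leq_trans lt_im) ?leq_addr.
(* The limit is read off diagonally: by [stab], the coefficient of index [n] no longer changes from
   [it n.+1] on. *)
exists (Fps (fun n => it n.+1 n)); apply/fpsP => -[|n].
  by rewrite [LHS]it0 coef_fpsD coef_fpsXM addr0.
rewrite [LHS]itS [RHS]coef_fpsD coef_fpsXM coef_fps1 add0r.
apply: (@cont_step_eq _ _ n) (leqnn n) => i le_in.
by have := stab i.+1 i (n - i)%N (ltnSn i); rewrite addSn subnKC.
Qed.

(** Guess and verify: an arbitrary solution [P] of the quadratic yields a geometric family [H]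
    solving the linear system, and uniqueness identifies [P] with [cont_gf false 0]. *)
Lemma cont_gf_eq : let P := cont_gf false 0 in P = 1 + x * cont_step P.
Proof.
have [P PE] := cont_eq_exists.
pose L := 1 + x * fpsC * (1 - x) * P.
(* [q k] is the contribution of a descent as next step, that is, F_k - G_k. *)
pose q k := x * fpsC * P * \sum_(j < k) L ^+ j.
pose H (b : bool) k := P * L ^+ k - (if b then q k else 0).
have qE k : (1 - x) * q k = L ^+ k - 1.
  by rewrite subrX1 /q [L - 1]addrAC subrr add0r; ring.
have qS k : q k.+1 = q k + x * fpsC * P * L ^+ k.
  by rewrite /q big_ord_recr mulrDr.
(* The quadratic equation, rearranged so that [L ^+ k] factors out of the ascent equation [HT]. *)
have PL : P * (1 - x * L + x ^+ 2 * fpsC - x) = 1.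
  transitivity (P - x * cont_step P); first by rewrite /cont_step /L; ring.
  by apply/eqP; rewrite subr_eq -PE.
have HT k : H true k = 1 + x * (H true k.+1 + H false k).
  apply/eqP; rewrite -subr_eq0 /H qS exprS subr0.
  have -> : P * L ^+ k - q k -
      (1 + x * (P * (L * L ^+ k) - (q k + x * fpsC * P * L ^+ k) + P * L ^+ k))
    = L ^+ k * (P * (1 - x * L + x ^+ 2 * fpsC - x)) - (1 - x) * q k - 1 by ring.
  by rewrite PL qE; apply/eqP; ring.
have HE b k : H b k = 1 + x * (H true k.+1 + H false k +
     (if b then 0 else fpsC * \sum_(j < k) H false j)).
  case: b; first by rewrite addr0 HT.
  rewrite mulrDr addrA -HT /H subr0.
  under eq_bigr => j _ do rewrite subr0.
  by rewrite -mulr_sumr /q; ring.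
have -> : cont_gf false 0 = P by rewrite (cont_gf_unique HE) /H expr0 mulr1 subr0.
exact: PE.
Qed.

End ContinuationSeries.

(** * Value and derivative at y = 1, with y the polynomial variable ['X] *)

Section DerivativeAtOne.
Variable R : comNzRingType.
Implicit Types f g : fps {poly R}.

Definition fps_eval1 f : fps R := Fps (fun n => (f n).[1]).
Definition fps_deriv1 f : fps R := Fps (fun n => (f n)^`().[1]).

Lemma fps_eval1D f g : fps_eval1 (f + g) = fps_eval1 f + fps_eval1 g.
Proof. by apply/fpsP => n; rewrite /= hornerD. Qed.

Lemma fps_eval1N f : fps_eval1 (- f) = - fps_eval1 f.
Proof. by apply/fpsP => n; rewrite /= hornerN. Qed.

Lemma fps_eval1M f g : fps_eval1 (f * g) = fps_eval1 f * fps_eval1 g.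
Proof.
by apply/fpsP => n; rewrite /= horner_sum; apply: eq_bigr => i _; rewrite hornerM.
Qed.

Lemma fps_eval1_1 : fps_eval1 1 = 1.
Proof. by apply/fpsP => n; rewrite /= -polyC_natr hornerC. Qed.

Lemma fps_eval1X : fps_eval1 fpsX = fpsX.
Proof. by apply/fpsP => n; rewrite /= -polyC_natr hornerC. Qed.

Lemma fps_eval1C : fps_eval1 (fpsC 'X) = 1.
Proof. by apply/fpsP => -[|n]; rewrite /= ?hornerX ?horner0. Qed.

Lemma fps_deriv1D f g : fps_deriv1 (f + g) = fps_deriv1 f + fps_deriv1 g.
Proof. by apply/fpsP => n; rewrite /= derivD hornerD. Qed.

Lemma fps_deriv1N f : fps_deriv1 (- f) = - fps_deriv1 f.
Proof. by apply/fpsP => n; rewrite /= derivN hornerN. Qed.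

Lemma fps_deriv1M f g :
  fps_deriv1 (f * g) = fps_deriv1 f * fps_eval1 g + fps_eval1 f * fps_deriv1 g.
Proof.
apply/fpsP => n; rewrite coef_fpsD !coef_fpsM -big_split /=.
rewrite raddf_sum horner_sum; apply: eq_bigr => i _.
by rewrite /= derivM hornerD !hornerM.
Qed.

Lemma fps_deriv1_1 : fps_deriv1 1 = 0.
Proof. by apply/fpsP => n; rewrite /= -polyC_natr derivC horner0. Qed.

Lemma fps_deriv1X : fps_deriv1 fpsX = 0.
Proof. by apply/fpsP => n; rewrite /= -polyC_natr derivC horner0. Qed.

Lemma fps_deriv1C : fps_deriv1 (fpsC 'X) = 1.
Proof. by apply/fpsP => -[|n]; rewrite /= ?derivX ?hornerC ?deriv0 ?horner0. Qed.

Definition fps_eval1E :=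
  (fps_eval1D, fps_eval1N, fps_eval1M, fps_eval1_1, fps_eval1X, fps_eval1C).
Definition fps_deriv1E :=
  (fps_deriv1D, fps_deriv1N, fps_deriv1M, fps_deriv1_1, fps_deriv1X, fps_deriv1C).

End DerivativeAtOne.

(** * The closed form *)

Lemma total_des_gfE :
  total_des_gf ltn gtn = fpsX * fps_deriv1 (cont_gf ('X : {poly rat}) false 0).
Proof.
apply/fpsP => n; rewrite total_des_gf_deriv coef_fpsXM; case: n => [|n] /=.
  rewrite raddf_sum horner_sum big1 // => t _.
  have := des_le_size (word_of t); rewrite size_word_of leqn0 => /eqP->.
  by rewrite /= derivXn mulr0n horner0.
by rewrite (sum_avoiding_catalan_words (fun w => 'X^(des w))).
Qed.

Theorem corollary3p9 :
  let x : fps rat := fpsX in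
  let s : fps rat := fps_sqrt (1 - 4 * x + 2 * x ^+ 2 + x ^+ 4) in
  let D : fps rat := total_des_gf ltn gtn in
  2 * (1 - x) * x * s * D = 1 - 4 * x + 3 * x ^+ 2 - (1 - 2 * x) * s.
Proof.
move=> x s D.
pose P := cont_gf ('X : {poly rat}) false 0.
pose p := fps_eval1 P; pose d := fps_deriv1 P.
have PE : P = 1 + fpsX * cont_step 'X P by exact: cont_gf_eq.
have pE : p = 1 + x * (p + p + x * ((1 - x) * (p * p) - p)).
  by rewrite {1}/p PE /cont_step !fps_eval1E mul1r.
have dE : d = x * (d + d + x * ((1 - x) * (p * p) - p +
                                ((1 - x) * (d * p + p * d) - d))).
  rewrite {1}/d PE /cont_step !(fps_deriv1E, fps_eval1E) -/x -/p -/d; ring.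
(* The right side has constant term 1, and its square differs from the radicand by a multiple of the
   equation [pE]; uniqueness of the root concludes. *)
have sE : s = 1 - x ^+ 2 - 2 * x * (1 - x) * (1 + x * p).
  apply/esym/fps_sqrt_unique.
    set c := 1 + x * p.
    have -> : 1 - x ^+ 2 - 2 * x * (1 - x) * c =
              1 - x * (x + 2 * (1 - x) * c) by ring.
    by rewrite coef_fpsD coef_fpsN coef_fpsXM subr0.
  have -> : 1 - 4 * x + 2 * x ^+ 2 + x ^+ 4 =
      (1 - x ^+ 2 - 2 * x * (1 - x) * (1 + x * p)) ^+ 2 -
      4 * x ^+ 2 * (1 - x) *
      (1 + x * (p + p + x * ((1 - x) * (p * p) - p)) - p) by ring.
  by rewrite -pE subrr mulr0 subr0.
rewrite /D total_des_gfE -/P -/d -/x sE.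
apply/eqP; rewrite -subr_eq0; apply/eqP.
set e1 := (X in d = X) in dE; set e2 := (X in p = X) in pE.
(* In [d - e1] the coefficient of [d] is exactly [s], and subtracting [p - e2] cancels the terms in
   [p * p], leaving [s * d + 1 - (1 - 2 * x) * p]. *)
transitivity (2 * (1 - x) * x ^+ 2 * (d - e1 - (p - e2))); last first.
  by rewrite -dE -pE !subrr mulr0.
rewrite /e1 /e2; ring.
Qed.
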